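(* In the inventory control problem with possibly finite order size $L$ and possibly finite storage capacity $M$, with lost sales or with backorders, for each $t=0,1,2,\dots$ the finite-horizon expected total discounted value function $u_t^*:X\to\mathbb{R}$ is continuous, and these functions satisfy the optimality equations $u_0^*(x)=0$ and $$u_{t+1}^*(x)=\min_{y\in\Phi(x)}\Big\{c_1\mathbf{1}_{\{y>0\}}(y)+c_2y+\mathbb{E}\,h(T(x+y-D))+\alpha\,\mathbb{E}\,u_t^*(T(x+y-D))\Big\},\qquad x\in X .$$ Furthermore, there exists an optimal policy $\pi_t^*=(\varphi_0^*,\dots,\varphi_t^* )$ that achieves $u_t^*$.
   Context: Setting. $L\in(0,+\infty]$ is the maximal order size and $M\in(0,+\infty]$ the storage capacity. In the lost-sales case $S=[0,+\infty)$ and $T(x)=x^+=\max(x,0)$; in the backorders case $S=\mathbb{R}$ and $T(x)=x$. The state space is $X=S\cap(-\infty,M]$ if $M<+\infty$ and $X=S$ otherwise; the action space is $Y=[0,L]$ if $L<+\infty$ and $Y=[0,+\infty)$ otherwise (Euclidean topologies). The feasible order sets are $\Phi(x)=[0,\min(L,M-x)]$ if $L,M<+\infty$; $\Phi(x)=[0,L]$ if $L<+\infty$, $M=+\infty$; $\Phi(x)=[0,M-x]$ if $L=+\infty$, $M<+\infty$; $\Phi(x)=[0,+\infty)$ if $L=M=+\infty$. The state evolves by $x_{t+1}=T(x_t+y_t-D_{t+1})$, where $D_1,D_2,\dots$ are i.i.d. nonnegative random variables (demands), and $D$ denotes a random variable with the same distribution. The constants satisfy $c_1,c_2>0$ and $\alpha\in(0,1]$.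 The function $h:\mathbb{R}\to[0,+\infty)$ is convex with $h(0)=0$ and $\lim_{|z|\to+\infty}h(z)=+\infty$, and $\mathbb{E}\,h(z-D)<+\infty$ for each $z\in X$. Objective functions on $\mathrm{Gr}(\Phi)=\{(x,y):x\in X,\ y\in\Phi(x)\}$: $u_0(x,y)=0$ and $$u_{t+1}(x,y)=c_1\mathbf{1}_{\{y>0\}}(y)+c_2y+\mathbb{E}\,h(T(x+y-D))+\alpha\,\mathbb{E}\,u_t^*(T(x+y-D)),$$ where $u_t^*(x)=\inf_{y\in\Phi(x)}u_t(x,y)$. A policy $(\varphi_0^*,\dots,\varphi_t^* )$ of maps $\varphi_s^*:X\to Y$ with $\varphi_s^*(x)\in\Phi(x)$ is optimal and achieves $u_t^*$ when $u_s(x,\varphi_s^*(x))=u_s^*(x)$ for all $x\in X$ and $s=0,\dots,t$.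
   Formalization: With backorders and finite order size L, the assumption that E h(z−D) is finite is strengthened to finiteness of E h(z−D_1−…−D_n) for all n and all z in X, since otherwise u_2^* can be identically +∞ (e.g. h(z)=exp(z²)−1, D with density proportional to exp(−s²−s^{3/2})). *)

(* Defs.v *)
From HB Require Import structures.
From mathcomp Require Import all_boot all_order all_algebra.
From mathcomp Require Import all_classical all_reals all_analysis.

Set Implicit Arguments.
Unset Strict Implicit.
Unset Printing Implicit Defensive.

Import Order.TTheory GRing.Theory Num.Theory.
Import numFieldTopology.Exports numFieldNormedType.Exports.

Local Open Scope classical_set_scope.
Local Open Scope ring_scope.

Variant shortage := LostSales | Backorders.

(* Data of the inventory problem; [demand] is a random variable D with the
   common law of the i.i.d. demands. The recursion for the value functions
   involves the demand process only through this law. *)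
Record inventory (R : realType) (d : measure_display) (Omega : measurableType d)
    (P : probability Omega R) := Inventory {
  mode : shortage ;
  max_order : \bar R ;                 (* L *)
  capacity : \bar R ;                  (* M *)
  fixed_cost : R ;                     (* c_1 *)
  unit_cost : R ;                      (* c_2 *)
  discount : R ;                       (* alpha *)
  holding : R -> R ;                   (* h *)
  demand : {RV P >-> R}                (* D *)
}.

Section Inventory.
Context (R : realType) (d : measure_display) (Omega : measurableType d).
Context (P : probability Omega R) (I : inventory P).

Local Notation L := (max_order I).
Local Notation M := (capacity I).
Local Notation h := (holding I).
Local Notation D := (demand I).

Definition stock_levels : set R :=
  match mode I with LostSales => [set x | 0 <= x] | Backorders => setT end.

Definition settle (z : R) : R :=
  match mode I with LostSales => Num.max z 0 | Backorders => z end.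

(* X ; the second condition is void when M = +oo *)
Definition state : set R := stock_levels `&` [set x | (x%:E <= M)%E].

(* Phi(x) ; the arithmetic of \bar R gives M - x = +oo when M = +oo, so this
   covers the four cases for (L, M) at once *)
Definition feasible (x : R) : set R :=
  [set y | 0 <= y /\ (y%:E <= Order.min L (M - x%:E))%E].

(* u^*(x) = inf_{y in Phi(x)} u(x, y) *)
Definition value (u : R -> R -> \bar R) (x : R) : \bar R :=
  ereal_inf [set u x y | y in feasible x].

Definition bellman (v : R -> \bar R) (x y : R) : \bar R :=
  ((fixed_cost I * (0 < y)%R%:R + unit_cost I * y)%:E
   + 'E_P[fun w => h (settle (x + y - D w))]
   + (discount I)%:E * \int[P]_w v (settle (x + y - D w)))%E.

(* u_t, valued in [0, +oo]; only its values on Gr(Phi) are meaningful *)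
Fixpoint objective (t : nat) : R -> R -> \bar R :=
  if t is s.+1 then bellman (value (objective s)) else fun _ _ => 0%E.

Definition opt_value (t : nat) : R -> \bar R := value (objective t).

(* E h(z - D_1 - ... - D_n) for D_1, ..., D_n i.i.d. copies of D, written as an
   iterated expectation. It matters for backorders with a finite order size,
   where demand may accumulate faster than it can be replenished: there,
   finiteness of E h(z - D) for all z does not prevent u_2^* = +oo. Example:
   h(z) = exp(z^2) - 1 and D with density proportional to
   exp(- s^2 - s^(3/2)) on [0, +oo). *)
Fixpoint holding_after (n : nat) (z : R) : \bar R :=
  if n is m.+1 then (\int[P]_w holding_after m (z - D w))%E else (h z)%:E.

Record inventory_axioms : Prop := {
  max_order_gt0 : (0 < L)%E ;
  capacity_gt0 : (0 < M)%E ;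
  fixed_cost_gt0 : 0 < fixed_cost I ;
  unit_cost_gt0 : 0 < unit_cost I ;
  discount_gt0 : 0 < discount I ;
  discount_le1 : discount I <= 1 ;
  demand_ge0 : forall w, 0 <= D w ;
  holding_ge0 : forall z, 0 <= h z ;
  holding_convex : convex_function [set: R] (h : R -> R^o) ;
  holding0 : h 0 = 0 ;
  holding_pinfty : h z @[z --> +oo] --> +oo ;
  holding_ninfty : h z @[z --> -oo] --> +oo ;
  holding_integrable : forall z, state z -> ('E_P[fun w => h (z - D w)] < +oo)%E
}.

Definition optimal_policy (t : nat) (phi : 'I_t.+1 -> R -> R) : Prop :=
  forall (s : 'I_t.+1) (x : R), state x ->
    feasible x (phi s x) /\ objective s x (phi s x) = opt_value s x.

End Inventory.

Definition is_minimum (R : realType) (A : set (\bar R)) (m : \bar R) : Prop :=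
  A m /\ lbound A m.

(* Main.v *)
Require Import Defs.
From HB Require Import structures.
From mathcomp Require Import all_boot all_order all_algebra lra ring.
From mathcomp Require Import all_classical all_reals all_analysis.
From mathcomp Require Import measurable_realfun.

Import Order.TTheory GRing.Theory Num.Theory.
Import numFieldTopology.Exports numFieldNormedType.Exports.

Local Open Scope classical_set_scope.
Local Open Scope ring_scope.

(** Suppose that [u_t^*] is finite and continuous. The cost of an order [y] at stock
    [x] is then [c_1 1_{y > 0} + c_2 y + G (x + y)], where [G] collects the expected
    holding and continuation costs as a function of the stock after ordering
    ([bellman_order_cost]). Everything rests on [G] being finite and continuous.

    Given that, an optimal order exists because [c_2 > 0] confines the useful orders to
    a compact set, on which the cost is continuous except for a downward jump at [y = 0]
    ([optimal_order_exists]). The minimum is continuous in [x] because an optimal order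
    at [x] can be imitated at a nearby stock by a feasible order that is slightly
    smaller: the set-up and purchase costs do not increase, and the change in [G] is
    controlled by uniform continuity on a segment ([value_upper_modulus]).

    Finiteness and continuity of [G] come from dominated convergence
    ([expectation_continuous]), and the difficulty is to find a dominating random
    variable. Stock after demand never exceeds the stock before it, so only the
    behaviour of the integrand at low stock matters; it is described by a nonincreasing
    tail [q], such that the integrand is at most a constant plus [q] below each stock
    level, and [q (T (a - D))] is integrable for each state [a] ([tail_bound],
    [dominated]). The nonincreasing part of [h] is such a tail for [h]. A tail for
    [u_t^*] is obtained by induction on [t] from a simple order ([tail_family]):

    - if orders are bounded or sales are lost, order nothing. The tail is the sum of the
      expected shortage costs after 1, ..., t periods; they vanish for lost sales, and
      for backorders they are at most the iterated expectations of [h], which are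
      finite by hypothesis ([dominated_value_no_order]);
    - with backorders and unbounded orders, raise the stock to a fixed level. The tail
      is [c_2 max(-x, 0)], whose expectation is finite since [h] grows at least
      linearly at minus infinity ([dominated_value_order_up]). *)

(** * Real functions and integrals *)

Section Analysis.
Context {R : realType}.
Implicit Types (f h : R -> R) (x y t : R).

Lemma convex_functionP h : convex_function [set: R] (h : R -> R^o) ->
  forall t x y, 0 <= t <= 1 ->
  h (t * x + (1 - t) * y) <= t * h x + (1 - t) * h y.
Proof.
move=> hconv t x y /andP[t0 t1].
have /= := hconv (Itv01 t0 t1) x y (in_setT x) (in_setT y).
by rewrite !convRE.
Qed.

(** The slope of a convex function over a fraction of a step is squeezed between
    the slopes of the full step forward and the full step backward. *)
Lemma convex_step h : convex_function [set: R] (h : R -> R^o) ->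
  forall x t e, 0 <= t <= 1 ->
  `|h (x + t * e) - h x| <= t * (`|h (x + e) - h x| + `|h (x - e) - h x|).
Proof.
move=> /convex_functionP hconv x t e /andP[t0 t1].
have up : h (x + t * e) - h x <= t * (h (x + e) - h x).
  have := hconv t (x + e) x; rewrite t0 t1 => /(_ isT).
  have -> : t * (x + e) + (1 - t) * x = x + t * e by ring.
  by move=> ?; lra.
(* [x] is the average of [x + t e] and [x - e] with weights 1 and [t]. *)
have down : h x - h (x + t * e) <= t * (h (x - e) - h x).
  have t10 : 0 < 1 + t by lra.
  have s01 : 0 <= (1 + t)^-1 <= 1 by rewrite invr_ge0 ltW//= invf_le1//; lra.
  have := hconv _ (x + t * e) (x - e) s01.
  have -> : (1 + t)^-1 * (x + t * e) + (1 - (1 + t)^-1) * (x - e) = x.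
    by field; lra.
  rewrite -(ler_pM2l t10) mulrDr !mulrA divff; last by lra.
  have -> : (1 + t) * (1 - (1 + t)^-1) = t by field; lra.
  by move=> ?; lra.
have := ler_norm (h (x + e) - h x); have := ler_norm (h (x - e) - h x).
move: (normr_ge0 (h (x + e) - h x)) (normr_ge0 (h (x - e) - h x)).
rewrite ler_norml.
set a := `|h (x + e) - h x|; set b := `|h (x - e) - h x| => *.
by apply/andP; split; nra.
Qed.

Lemma convex_continuous h : convex_function [set: R] (h : R -> R^o) ->
  continuous h.
Proof.
move=> hconv x; apply/cvgrPdist_lt => e e0.
set C := `|h (x + 1) - h x| + `|h (x - 1) - h x|.
have C0 : 0 <= C by rewrite addr_ge0.
have d0 : 0 < Num.min 1 (e / (C + 1)) by rewrite lt_min ltr01 divr_gt0// ltr_wpDl.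
apply/nbhs_ballP; exists (Num.min 1 (e / (C + 1))) => //= y.
rewrite /ball/= lt_min [`|x - y|]distrC => /andP[/ltW y1].
rewrite ltr_pdivlMr ?ltr_wpDl// => ye.
have [s [s1 yE]] : exists s : R, `|s| = 1 /\ y = x + `|y - x| * s.
  have [xy|yx] := leP 0 (y - x).
    by exists 1; rewrite normr1 ger0_norm//; split => //; ring.
  by exists (-1); rewrite normrN1 ltr0_norm//; split => //; ring.
have sE : `|h (x + s) - h x| + `|h (x - s) - h x| = C.
  by move/eqP: s1; rewrite eqr_norml ler01 andbT => /orP[] /eqP ->;
    rewrite ?opprK// addrC.
rewrite distrC {1}yE (le_lt_trans (convex_step h hconv x _ s _)) ?normr_ge0//.
by rewrite sE (le_lt_trans _ ye)// ler_wpM2l// lerDl.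
Qed.

(** Heine-Cantor on a segment; only one of the two points has to lie in the
    segment, so that its neighbours need no separate treatment at the ends. *)
Lemma segment_uniform f x y : continuous f ->
  forall e, 0 < e -> exists2 d, 0 < d & forall s t, x <= s <= y ->
    `|s - t| < d -> `|f s - f t| < e.
Proof.
move=> cf e e0.
have /compact_near_coveringP := @segment_compact R x y.
pose Q d s := forall t, `|s - t| < d -> `|f s - f t| < e.
move=> /(_ R (0:R)^'+ Q _)[s _|d /= d0 dQ].
  have /cvgrPdist_lt/(_ (e / 2)) := cf s.
  rewrite divr_gt0// => /(_ isT)/nbhs_ballP[d /= d0 sd].
  have d20 : 0 < d / 2 by rewrite divr_gt0.
  near=> s' d' => t s't.
  have ss' : `|s - s'| < d / 2.
    by near: s'; apply/nbhs_ballP; exists (d / 2).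
  have d'd : d' < d / 2 by near: d'; exact: nbhs_right_lt.
  have st : `|s - t| < d.
    rewrite (le_lt_trans (ler_distD s' s t))// [ltRHS]splitr ltrD//.
    exact: lt_trans s't d'd.
  have ss'd : `|s - s'| < d by rewrite (lt_trans ss')//; lra.
  have fs' := sd s' ss'd; have ft := sd t st.
  rewrite (le_lt_trans (ler_distD (f s) (f s') (f t)))// [ltRHS]splitr.
  by rewrite ltrD// distrC.
exists (d / 2) => [|s t]; first by rewrite divr_gt0.
move=> sxy st; apply: (dQ (d / 2)) => //=.
- rewrite sub0r normrN gtr0_norm; lra.
- lra.
Unshelve. all: end_near. Qed.

Lemma nonincreasing_emeasurable (q : R -> \bar R) :
  {homo q : x y / x <= y >-> (y <= x)%E} -> measurable_fun [set: R] q.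
Proof.
move=> qni; apply: (measurability _ (ErealGenOInfty.measurableE R)).
move=> /= _ [_ [a ->]] <-; rewrite setTI; apply: is_interval_measurable.
move=> s t /=; rewrite !in_itv/= !andbT => qs qt u /andP[su ut].
by rewrite in_itv/= andbT (lt_le_trans qt)// qni.
Qed.

End Analysis.

(** The integral of a nonnegative function is a supremum over the simple functions
    below it, hence is monotone without any measurability; iterated expectations such
    as [holding_after] can then be compared directly. *)
Lemma ge0_le_integralT {d} {T : measurableType d} {R : realType}
    (mu : {measure set T -> \bar R}) (f g : T -> \bar R) :
  (forall w, 0 <= f w)%E -> (forall w, f w <= g w)%E ->
  (\int[mu]_w f w <= \int[mu]_w g w)%E.
Proof.
move=> f0 fg; rewrite !ge0_integralTE//; last by move=> w; exact: le_trans (fg w).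
by apply: ereal_sup_le => _ [s sf <-]; exists s => // w; exact: le_trans (fg w).
Qed.

Section Model.
Context {R : realType} {d : measure_display} {Omega : measurableType d}.
Context {P : probability Omega R} {I : inventory P}.
Hypothesis HI : inventory_axioms I.

Local Notation L := (max_order I).
Local Notation M := (capacity I).
Local Notation h := (holding I).
Local Notation D := (demand I).
Local Notation T := (settle I).
Local Notation X := (state I).

(** * States, demand and feasible orders *)

Lemma le_settle : {homo T : x y / x <= y}.
Proof.
move=> x y xy; rewrite /settle; case: (mode I) => //.
by rewrite ge_max !le_max xy lexx orbT.
Qed.

Lemma continuous_settle : continuous T.
Proof.
move=> x; rewrite /settle; case: (mode I); last exact: cvg_id.
by apply: continuous_max; [exact: cvg_id|exact: cvg_cst].
Qed.

Lemma state_settle {x} : X x -> T x = x.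
Proof.
by rewrite /settle => -[]; rewrite /stock_levels; case: (mode I) => //= /max_l.
Qed.

Lemma stock_levels_settle x : stock_levels I (T x).
Proof.
by rewrite /stock_levels /settle; case: (mode I) => //=; rewrite le_max lexx orbT.
Qed.

Lemma le_demand_settle {z} w : X z -> T (z - D w) <= z.
Proof.
move=> Xz; rewrite -[leRHS](state_settle Xz); apply: le_settle.
by have := demand_ge0 HI w; lra.
Qed.

Lemma state_demand {z} w : X z -> X (T (z - D w)).
Proof.
move=> Xz; split; first exact: stock_levels_settle.
by case: (Xz) => _ /=; apply: le_trans; rewrite lee_fin le_demand_settle.
Qed.

(** A continuous nondecreasing retraction of the line onto the state space. It
    turns continuity on the states into continuity on the whole line. *)
Definition to_state (x : R) : R :=
  if M is r%:E then Num.min (T x) r else T x.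

Lemma to_state_in x : X (to_state x).
Proof.
rewrite /to_state; have := capacity_gt0 HI; rewrite /state.
case: M => [r||] //= M0; split => /=.
- have := stock_levels_settle x; rewrite /stock_levels.
  by case: (mode I) => //= Tx0; rewrite le_min Tx0 ltW.
- by rewrite lee_fin ge_min lexx orbT.
- exact: stock_levels_settle.
- exact: leey.
Qed.

Lemma to_state_id {x} : X x -> to_state x = x.
Proof.
move=> Xx; rewrite /to_state (state_settle Xx); case: Xx => _ /=.
by case: M => //= r; rewrite lee_fin => /min_l.
Qed.

Lemma le_to_state : {homo to_state : x y / x <= y}.
Proof.
move=> x y xy; rewrite /to_state; case: M => [r||]; try exact: le_settle.
by rewrite le_min !ge_min le_settle //= lexx orbT.
Qed.

Lemma continuous_to_state : continuous to_state.
Proof.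
rewrite /to_state; case: M => [r||]; try exact: continuous_settle.
by move=> x; apply: continuous_min; [exact: continuous_settle|exact: cvg_cst].
Qed.

Lemma measurable_after_demand z :
  measurable_fun [set: Omega] (fun w => T (z - D w) : R).
Proof.
apply: (measurableT_comp (f := T)).
  by apply: nondecreasing_measurable => //; exact: le_settle.
by apply: measurable_funB => //; exact: measurable_cst.
Qed.

Lemma feasible0 x : X x -> feasible I x 0.
Proof.
move=> [_ xM]; split => //; rewrite le_min sube_ge0 ?xM ?orbT// andbT.
exact: ltW (max_order_gt0 HI).
Qed.

Lemma state_feasible {x y} : X x -> feasible I x y -> X (x + y).
Proof.
move=> [Sx xM] [y0]; rewrite le_min => /andP[_ yMx]; split.
  by move: Sx; rewrite /stock_levels; case: (mode I) => //= x0; exact: addr_ge0.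
by rewrite /= addrC EFinD -leeBrDr.
Qed.

(** Shrinking an order never increases its set-up and purchase costs, so moving to a
    nearby state needs an order that is feasible there and only slightly smaller. *)
Lemma feasible_nearby x x' y : X x' -> feasible I x y ->
  exists y', [/\ feasible I x' y', y' <= y & y - y' <= `|x - x'|].
Proof.
move=> Xx' [y0]; rewrite le_min => /andP[yL yMx].
have [yx|xy] := leP y `|x - x'|.
  by exists 0; split => //; [exact: feasible0|rewrite subr0].
exists (y - `|x - x'|); split; last 2 first.
- by rewrite gerBl.
- by rewrite subKr.
split; first by rewrite subr_ge0 ltW.
rewrite le_min; apply/andP; split.
  by apply: le_trans yL; rewrite lee_fin gerBl.
rewrite leeBrDr// -EFinD; apply: le_trans (_ : ((y + x)%:E <= _)%E).
  by rewrite lee_fin; have := ler_norm (x' - x); rewrite distrC; lra.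
by rewrite EFinD -leeBrDr.
Qed.

Lemma value_le_feasible u x y : feasible I x y -> (value I u x <= u x y)%E.
Proof. by move=> xy; apply: ereal_inf_lbound; exists y. Qed.

(** * Expectations dominated by a tail *)

(** The shape of the dominating functions: as [q] decreases, its values at
    [T (z - D)] for all states [z >= a] lie below the single random variable
    [q (T (a - D))], which has a finite expectation. *)
Definition tail_bound (q : R -> \bar R) : Prop :=
  [/\ forall x, (0 <= q x)%E,
      {homo q : x y / x <= y >-> (y <= x)%E},
      forall x, X x -> (q x < +oo)%E &
      forall x, X x -> (\int[P]_w q (T (x - D w)) < +oo)%E].

(** Below any given stock level, [v] exceeds the tail by at most a constant. The
    constant may depend on the level because stock after demand never exceeds the
    stock before it. *)
Definition dominated (q v : R -> \bar R) : Prop :=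
  forall b, X b -> exists2 C : R, 0 <= C &
    forall x, X x -> x <= b -> (v x <= C%:E + q x)%E.

Lemma measurable_tail (q : R -> \bar R) z : {homo q : x y / x <= y >-> (y <= x)%E} ->
  measurable_fun [set: Omega] (fun w => q (T (z - D w))).
Proof.
move=> qni; apply: (measurableT_comp (f := q)).
  exact: nonincreasing_emeasurable.
exact: measurable_after_demand.
Qed.

(** Demand only lowers the stock, so the constant that works below [b] is still
    valid after demand and survives integration against a probability. *)
Lemma dominated_integral {q v} : tail_bound q -> (forall x, X x -> (0 <= v x)%E) ->
  dominated q v ->
  dominated (fun x => \int[P]_w q (T (x - D w)))%E
            (fun x => \int[P]_w v (T (x - D w)))%E.
Proof.
move=> [q0 qni _ _] v0 vq b Xb; have [C C0 vC] := vq b Xb.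
exists C => // x Xx xb.
apply: (@le_trans _ _ (\int[P]_w (C%:E + q (T (x - D w))))%E).
  apply: ge0_le_integralT => w; first exact/v0/state_demand.
  by apply: vC; [exact: state_demand|exact: le_trans (le_demand_settle _ Xx) xb].
rewrite ge0_integralD//; last exact: measurable_tail.
by rewrite integral_cst// [X in (_ * X + _)%E](probability_setT P) mule1.
Qed.

(** Dominated convergence near a state [z]: all states within distance 1 of [z] are
    at most [b] and at least [a], so the constant of [dominated] for [b] plus
    [q (T (a - D))] dominates the integrands. *)
Lemma expectation_continuous (V : R -> R) (q : R -> \bar R) :
  continuous V -> (forall x, 0 <= V x) -> tail_bound q ->
  dominated q (EFin \o V) ->
  exists G : R -> R, [/\ continuous G, forall z, 0 <= G z &
    forall z, X z -> (\int[P]_w (V (T (z - D w)))%:E)%E = (G z)%:E].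
Proof.
move=> cV V0 tq Vq; have [q0 qni qfin qint] := tq.
pose f z w := V (T (to_state z - D w)).
have mf z : measurable_fun [set: Omega] (f z).
  apply: (measurableT_comp (f := V)); first exact: continuous_measurable_fun.
  exact: measurable_after_demand.
have intf z : P.-integrable [set: Omega] (EFin \o f z).
  apply/integrableP; split; first exact/measurable_EFinP.
  under eq_integral => w _ do rewrite /= ger0_norm ?V0//.
  have V0' x : X x -> (0 <= (EFin \o V) x)%E by rewrite lee_fin V0.
  have [C C0] := dominated_integral tq V0' Vq _ (to_state_in z).
  move=> /(_ _ (to_state_in z) (lexx _)) /le_lt_trans; apply.
  by rewrite lte_add_pinfty ?ltry// qint//; exact: to_state_in.
exists (fun z => \int[P]_w f z w)%R; split.
- move=> z.
  set a := to_state (z - 1); set b := to_state (z + 1).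
  have [C C0 VC] := Vq b (to_state_in _).
  have Xa : X a by exact: to_state_in.
  pose g w := C + fine (q (T (a - D w))).
  have qfinE w : (fine (q (T (a - D w))))%:E = q (T (a - D w)).
    rewrite fineK// ge0_fin_numE//; exact/qfin/state_demand.
  have intg : P.-integrable [set: Omega] (EFin \o g).
    apply: (eq_integrable _ (cst C%:E \+ (fun w => q (T (a - D w))))%E) => //.
      by move=> w _ /=; rewrite /g EFinD qfinE.
    apply: integrableD => //; first exact: finite_measure_integrable_cst.
    apply/integrableP; split; first exact: measurable_tail.
    under eq_integral => w _ do rewrite gee0_abs//.
    exact: qint.
  apply: (@continuity_under_integral _ _ _ P f setT measurableT (z - 1) (z + 1)
    _ _ g intg) => //.
  + apply: aeW => w _ x _.
    apply: (@continuous_comp _ _ _ (fun x => T (to_state x - D w)) V);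
      last exact: cV.
    apply: (@continuous_comp _ _ _ (fun x => to_state x - D w) T);
      last exact: continuous_settle.
    by apply: cvgB; [exact: continuous_to_state|exact: cvg_cst].
  + move=> x /=; rewrite in_itv/= => /andP[zx xz]; apply: aeW => w _.
    have Xx := to_state_in x.
    rewrite ger0_norm ?V0// -lee_fin EFinD qfinE.
    apply: (le_trans (VC _ (state_demand w Xx) _)).
      rewrite (le_trans (le_demand_settle _ Xx))//; exact/le_to_state/ltW.
    rewrite leeD2l// qni// le_settle// lerB//; exact/le_to_state/ltW.
  + by rewrite inE/= in_itv/=; lra.
- by move=> z; apply: Rintegral_ge0 => w _; exact: V0.
- move=> z Xz; rewrite /f to_state_id// /Rintegral fineK//.
  by have := integrable_fin_num _ (intf z); rewrite /f to_state_id//; apply.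
Qed.

(** * Tails of the holding cost and of the values *)

Lemma holding_shrink t x : 0 <= t <= 1 -> h (t * x) <= t * h x.
Proof.
move=> t01; have := convex_functionP h (holding_convex HI) t x 0 t01.
by rewrite !mulr0 (holding0 HI) mulr0 !addr0.
Qed.

(** A convex function with its minimum 0 at the origin is nondecreasing along each
    ray from the origin. *)
Lemma le_holding x y : 0 <= x <= y \/ y <= x <= 0 -> h x <= h y.
Proof.
move=> xy; have [y0|y0] := eqVneq y 0.
  by have -> : x = y by case: xy => /andP[]; lra.
have t01 : 0 <= x / y <= 1.
  case: xy => /andP[? ?].
    have y1 : 0 < y by lra.
    by rewrite ler_pdivrMr// mul1r divr_ge0//; lra.
  have y1 : y < 0 by lra.
  by rewrite ler_ndivrMr// mul1r -mulrNN -invrN divr_ge0//; lra.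
have := holding_shrink _ y t01; rewrite divfK// => /le_trans; apply.
by rewrite ler_piMl ?(holding_ge0 HI)//; case/andP: t01.
Qed.

Lemma holding_shortage_le x : h (Num.min x 0) <= h x.
Proof.
by case: (leP x 0) => // _; rewrite (holding0 HI) (holding_ge0 HI).
Qed.

(** The part of the holding cost due to negative stock, expected after [n] periods
    without orders. Unlike [holding_after], it is monotone in the stock, hence
    measurable and fit for dominated convergence. With lost sales it is zero at
    nonnegative stock. *)
Fixpoint shortage_tail (n : nat) (z : R) : \bar R :=
  if n is m.+1 then (\int[P]_w shortage_tail m (T (z - D w)))%E
  else (h (Num.min z 0))%:E.

Lemma shortage_tail_ge0 n z : (0 <= shortage_tail n z)%E.
Proof.
elim: n z => [|n IHn] z /=; first by rewrite lee_fin (holding_ge0 HI).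
exact: integral_ge0.
Qed.

Lemma shortage_tail_nincr n :
  {homo shortage_tail n : x y / x <= y >-> (y <= x)%E}.
Proof.
elim: n => [|n IHn] x y xy /=.
  rewrite lee_fin; apply: le_holding; right.
  by rewrite le_min !ge_min xy lexx !orbT.
apply: ge0_le_integralT => w; first exact: shortage_tail_ge0.
by apply/IHn/le_settle; rewrite lerB.
Qed.

Lemma shortage_tail1_lty x : X x -> (shortage_tail 1 x < +oo)%E.
Proof.
move=> Xx; apply: le_lt_trans (holding_integrable HI Xx); rewrite unlock /=.
apply: ge0_le_integralT => w; rewrite lee_fin ?(holding_ge0 HI)//.
rewrite /settle; case: (mode I); last exact: holding_shortage_le.
by rewrite min_r ?le_max ?lexx ?orbT// (holding0 HI) (holding_ge0 HI).
Qed.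

Lemma tail_bound_shortage : tail_bound (shortage_tail 0).
Proof.
split; [exact: shortage_tail_ge0|exact: shortage_tail_nincr| |].
- by move=> x _; rewrite ltry.
- exact: shortage_tail1_lty.
Qed.

Lemma dominated_holding : dominated (shortage_tail 0) (EFin \o h).
Proof.
move=> b Xb; exists (h (Num.max b 0)) => [|x Xx xb]; first exact: holding_ge0.
rewrite /= -EFinD lee_fin; case: (leP x 0) => [x0|x0].
  by rewrite lerDr (holding_ge0 HI).
rewrite (le_trans (y := h (Num.max b 0))) ?lerDl ?(holding_ge0 HI)//.
by apply: le_holding; left; rewrite ltW//= le_max xb.
Qed.

Lemma shortage_tail_lost_sales n z : mode I = LostSales -> 0 <= z ->
  shortage_tail n z = 0%E.
Proof.
move=> lost; elim: n z => [|n IHn] z z0 /=.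
  by rewrite min_r// (holding0 HI).
by apply: integral0_eq => w _; apply: IHn; rewrite /settle lost le_max lexx orbT.
Qed.

Lemma shortage_tail_backorders n z : mode I = Backorders ->
  (shortage_tail n z <= holding_after I n z)%E.
Proof.
move=> back; elim: n z => [|n IHn] z /=.
  by rewrite lee_fin holding_shortage_le.
apply: ge0_le_integralT => w; first exact: shortage_tail_ge0.
by rewrite {1}/settle back.
Qed.

(** Up to an additive constant, an upper bound on the cost of never ordering during
    [t] periods. *)
Definition total_shortage (t : nat) (z : R) : \bar R :=
  (\sum_(i < t) shortage_tail i.+1 z)%E.

Lemma integral_total_shortage t x :
  (\int[P]_w total_shortage t (T (x - D w)))%E =
  (\sum_(i < t) shortage_tail i.+2 x)%E.
Proof.
rewrite ge0_integral_sum// => [i|i w _]; last exact: shortage_tail_ge0.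
by apply: measurable_tail; exact: shortage_tail_nincr.
Qed.

Lemma tail_bound_total_shortage t :
  (forall n x, X x -> (shortage_tail n x < +oo)%E) ->
  tail_bound (total_shortage t).
Proof.
move=> fin; split => [x|x y xy|x Xx|x Xx].
- by apply: sume_ge0 => i _; exact: shortage_tail_ge0.
- by apply: lee_sum => i _; exact: shortage_tail_nincr.
- by apply: lte_sum_pinfty => i _; exact: fin.
- by rewrite integral_total_shortage; apply: lte_sum_pinfty => i _; exact: fin.
Qed.

(** The value is at most the cost of ordering nothing now, and after that order the
    shortages already counted in [total_shortage t] are met one period later. *)
Lemma dominated_value_no_order t v : tail_bound (total_shortage t) ->
  (forall x, X x -> (0 <= v x)%E) ->
  dominated (total_shortage t) v ->
  dominated (total_shortage t.+1) (value I (bellman I v)).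
Proof.
move=> tq v0 vq b Xb.
have h0 x : X x -> (0 <= (EFin \o h) x)%E by rewrite lee_fin (holding_ge0 HI).
have [C1 C10 hC] := dominated_integral tail_bound_shortage h0 dominated_holding _ Xb.
have [C2 C20 vC] := dominated_integral tq v0 vq _ Xb.
exists (C1 + C2) => [|x Xx xb]; first exact: addr_ge0.
apply: le_trans (value_le_feasible _ _ _ (feasible0 _ Xx)) _.
rewrite /bellman ltxx !mulr0 addr0 add0e addr0 unlock.
have := hC x Xx xb; have := vC x Xx xb; rewrite integral_total_shortage => {}vC {}hC.
(* The new first summand comes from this period's holding cost, the others from
   the continuation value. *)
rewrite /total_shortage big_ord_recl EFinD addeACA leeD//.
apply: le_trans vC; rewrite gee_pMl//.
- by apply: integral_ge0 => w _; exact/v0/state_demand.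
- by rewrite lee_fin (discount_le1 HI).
Qed.

Definition backlog (z : R) : \bar R := (Num.max (- z) 0)%:E.

(** A convex function that vanishes at 0 and exceeds 1 at some [z < 0] grows at least
    linearly to the left of [z]. *)
Lemma backlog_le_holding : exists2 K : R, 0 <= K & forall x,
  Num.max (- x) 0 <= K * (1 + h x).
Proof.
have /cvgryPge/(_ 1)[A [_ /= hA]] := holding_ninfty HI.
(* Strictly left of [A], so that [h z >= 1], and strictly negative. *)
pose z := Num.min A 0 - 1.
have z0 : z < 0.
  have : Num.min A 0 <= 0 by rewrite ge_min lexx orbT.
  by rewrite /z; lra.
have hz : 1 <= h z.
  apply: hA; have : Num.min A 0 <= A by rewrite ge_min lexx.
  by rewrite /z; lra.
exists (- z) => [|x]; first by lra.
have hx := holding_ge0 HI x.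
have zK : - z <= - z * (1 + h x) by rewrite ler_peMr//; lra.
rewrite ge_max; apply/andP; split; last by lra.
have [zx|xz] := leP z x; first by lra.
have t01 : 0 <= z / x <= 1.
  by rewrite ler_ndivrMr ?mul1r -1?mulrNN -1?invrN ?divr_ge0//; lra.
have := holding_shrink _ x t01; rewrite divfK; last by lra.
move=> hzx; have : - x * 1 <= - x * (z / x * h x) by rewrite ler_wpM2l//; lra.
have -> : - x * (z / x * h x) = - z * h x by field; lra.
lra.
Qed.

(** Since the holding cost grows at least linearly at minus infinity, its
    integrability makes the demand integrable. *)
Lemma tail_bound_backlog : mode I = Backorders ->
  tail_bound (fun x => (unit_cost I)%:E * backlog x)%E.
Proof.
move=> back; have c0 := unit_cost_gt0 HI.
have m0 (x : R) : 0 <= Num.max x 0 by rewrite le_max lexx orbT.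
split => [x|x y xy|x Xx|x Xx].
- by rewrite mule_ge0 ?lee_fin// ltW.
- rewrite lee_wpmul2l ?lee_fin ?(ltW c0)//.
  by rewrite ge_max !le_max lerN2 xy lexx orbT.
- by rewrite -EFinM ltry.
have [K K0 hK] := backlog_le_holding.
pose c := unit_cost I * K.
have c0' : 0 <= c by rewrite mulr_ge0// ltW.
apply: (@le_lt_trans _ _ (\int[P]_w (c%:E + c%:E * (h (x - D w))%:E))%E).
  apply: ge0_le_integralT => w; rewrite /backlog -!EFinM -?EFinD lee_fin.
    by rewrite mulr_ge0// ltW.
  have -> : c + c * h (x - D w) = unit_cost I * (K * (1 + h (x - D w))).
    by rewrite /c; ring.
  by rewrite /settle back ler_wpM2l ?hK// ltW.
have mh : measurable_fun [set: Omega] (fun w => (h (x - D w))%:E).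
  apply/measurable_EFinP; apply: (measurableT_comp (f := h)).
    by apply: continuous_measurable_fun; apply/convex_continuous/holding_convex.
  by apply: measurable_funB => //; exact: measurable_cst.
rewrite ge0_integralD//.
- rewrite integral_cst// [X in (_ * X + _)%E](probability_setT P) mule1.
  rewrite ge0_integralZl_EFin//; last by move=> w _; rewrite lee_fin (holding_ge0 HI).
  rewrite lte_add_pinfty ?ltry// lte_mul_pinfty ?lee_fin//.
  by have := holding_integrable HI Xx; rewrite unlock.
- by move=> w _; rewrite -EFinM lee_fin mulr_ge0// (holding_ge0 HI).
- exact: measurable_funeM.
Qed.

(** When orders are unbounded, the stock can be raised at once to the reference level
    [b]; the continuation cost is then the same for every initial stock, and only the
    linear ordering cost depends on it. *)
Lemma dominated_value_order_up q v : L = +oo%E -> tail_bound q ->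
  (forall x, X x -> (0 <= v x)%E) -> dominated q v ->
  dominated (fun x => (unit_cost I)%:E * backlog x)%E (value I (bellman I v)).
Proof.
move=> Loo tq v0 vq b Xb; have c0 := unit_cost_gt0 HI.
have h0 x : X x -> (0 <= (EFin \o h) x)%E by rewrite lee_fin (holding_ge0 HI).
have [C1 C10 hC] := dominated_integral tail_bound_shortage h0 dominated_holding _ Xb.
have [C2 C20 vC] := dominated_integral tq v0 vq _ Xb.
pose e := ('E_P[fun w => h (T (b - D w))] +
  (discount I)%:E * \int[P]_w v (T (b - D w)))%E.
have e0 : (0 <= e)%E.
  rewrite /e unlock adde_ge0 ?mule_ge0 ?lee_fin ?(ltW (discount_gt0 HI))//.
    by apply: integral_ge0 => w _; rewrite lee_fin (holding_ge0 HI).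
  by apply: integral_ge0 => w _; exact/v0/state_demand.
have eoo : (e < +oo)%E.
  have [_ _ _ qint] := tq; have [_ _ _ sint] := tail_bound_shortage.
  rewrite /e unlock lte_add_pinfty ?lte_mul_pinfty ?lee_fin ?(ltW (discount_gt0 HI))//.
    by rewrite (le_lt_trans (hC b Xb (lexx b)))// lte_add_pinfty ?ltry ?sint.
  by rewrite (le_lt_trans (vC b Xb (lexx b)))// lte_add_pinfty ?ltry ?qint.
have eE : (fine e)%:E = e by rewrite fineK// ge0_fin_numE.
exists (fixed_cost I + unit_cost I * `|b| + fine e) => [|x Xx xb].
  by rewrite !addr_ge0 ?mulr_ge0 ?fine_ge0 ?(ltW c0) ?(ltW (fixed_cost_gt0 HI)).
have bx : feasible I x (b - x).
  split; first by rewrite subr_ge0.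
  rewrite Loo le_min leey andTb EFinB leeB//.
  by case: Xb.
apply: le_trans (value_le_feasible _ _ _ bx) _.
have xbx : x + (b - x) = b by ring.
rewrite /bellman xbx -addeA -/e -eE /backlog -!EFinM -!EFinD lee_fin.
rewrite [leRHS]addrAC lerD2r -addrA lerD//.
  by rewrite ler_piMr ?(ltW (fixed_cost_gt0 HI))//; case: (0 < _).
rewrite -mulrDr ler_wpM2l ?(ltW c0)// lerD ?ler_norm//.
by rewrite le_max lexx.
Qed.

Definition inventory_accessible : Prop :=
  mode I = Backorders -> (L < +oo)%E ->
  forall n z, X z -> (holding_after I n z < +oo)%E.

(** With backorders and unbounded orders, the linear tail serves for every horizon. With
    backorders and bounded orders, the backlog may grow without control, which is where
    finite iterated expectations of the holding cost come in. With lost sales there is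
    no shortage cost at all. *)
Lemma tail_family : inventory_accessible ->
  exists Q : nat -> R -> \bar R, (forall t, tail_bound (Q t)) /\
    forall t v, (forall x, X x -> (0 <= v x)%E) -> dominated (Q t) v ->
      dominated (Q t.+1) (value I (bellman I v)).
Proof.
move=> Hacc.
have [[back Loo]|fin] : (mode I = Backorders /\ L = +oo%E) \/
    forall n x, X x -> (shortage_tail n x < +oo)%E.
  case Em : (mode I).
    right=> n x [+ _]; rewrite /stock_levels Em => x0.
    by rewrite shortage_tail_lost_sales ?ltry.
  have [Loo|Loo] := eqVneq L +oo%E; [by left|right=> n x Xx].
  apply: le_lt_trans (shortage_tail_backorders _ _ Em) (Hacc Em _ _ _ Xx).
  by rewrite ltey.
- exists (fun=> fun x => (unit_cost I)%:E * backlog x)%E.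
  have tq := tail_bound_backlog back; split => // _ v.
  exact: dominated_value_order_up.
- exists total_shortage; have tq t := tail_bound_total_shortage t fin.
  split => // t v; exact: dominated_value_no_order.
Qed.

(** * Optimal orders and continuity of the minimum *)

Definition order_cost (G : R -> R) (x y : R) : R :=
  fixed_cost I * (0 < y)%R%:R + unit_cost I * y + G (x + y).

(** The last two terms of the Bellman operator depend on stock and order only through
    the stock after ordering, as a continuous function of it. *)
Lemma bellman_order_cost (q v : R -> \bar R) (V : R -> R) : tail_bound q ->
  dominated q v -> continuous V -> (forall x, 0 <= V x) ->
  (forall x, X x -> v x = (V x)%:E) ->
  exists2 G : R -> R, continuous G /\ (forall z, 0 <= G z) &
    forall x y, X x -> feasible I x y -> bellman I v x y = (order_cost G x y)%:E.
Proof.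
move=> tq vq cV V0 vV.
have Vq : dominated q (EFin \o V).
  by move=> b /vq[C C0 vC]; exists C => // x Xx xb; rewrite /= -vV// vC.
have [G1 [cG1 G10 G1E]] := expectation_continuous _ _
  (convex_continuous _ (holding_convex HI)) (holding_ge0 HI)
  tail_bound_shortage dominated_holding.
have [G2 [cG2 G20 G2E]] := expectation_continuous _ _ cV V0 tq Vq.
have a0 := ltW (discount_gt0 HI).
exists (fun z => G1 z + discount I * G2 z) => [|x y Xx xy].
  split=> z; last by rewrite addr_ge0 ?mulr_ge0.
  by apply: cvgD; [exact: cG1|apply: cvgMl_tmp; exact: cG2].
have Xxy := state_feasible Xx xy.
rewrite /bellman unlock G1E// (eq_integral (fun w => (V (T (x + y - D w)))%:E)).
  by rewrite G2E// -EFinM -!EFinD /order_cost addrA.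
by move=> w _; rewrite vV//; exact: state_demand.
Qed.

Lemma order_cost0 (G : R -> R) x : order_cost G x 0 = G x.
Proof. by rewrite /order_cost ltxx !mulr0 !add0r addr0. Qed.

Lemma unit_cost_le_order_cost (G : R -> R) x y : (forall z, 0 <= G z) ->
  unit_cost I * y <= order_cost G x y.
Proof.
move=> G0; rewrite /order_cost addrAC lerDr addr_ge0// mulr_ge0//.
exact: ltW (fixed_cost_gt0 HI).
Qed.

Definition optimal_order (G : R -> R) (x y : R) : Prop :=
  feasible I x y /\ forall y', feasible I x y' ->
    order_cost G x y <= order_cost G x y'.

(** The set-up cost is discontinuous in the order only at 0. The positive orders of
    interest are bounded by [K], since a larger one costs more in purchase than
    ordering nothing; the continuous part of the cost has a minimizer [y1] on the
    feasible orders up to [K], and the optimum is the better of 0 and [y1]. *)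
Lemma optimal_order_exists (G : R -> R) x : continuous G -> (forall z, 0 <= G z) ->
  X x -> exists y, optimal_order G x y.
Proof.
move=> cG G0 Xx; have c20 := unit_cost_gt0 HI; have c10 := fixed_cost_gt0 HI.
pose K := G x / unit_cost I.
have K0 : 0 <= K by rewrite divr_ge0// ltW.
have KE : unit_cost I * K = G x by rewrite mulrC divfK// gt_eqF.
have [_ m0] := feasible0 x Xx.
(* [k] is the largest feasible order, or [K] when there is none. *)
have [k k0 kE] : exists2 k, 0 <= k &
    forall y, 0 <= y <= K -> feasible I x y <-> y <= k.
  move: m0; rewrite /feasible; case: (Order.min _ _) => [r||] //= r0.
    by exists r => // y /andP[y0 _]; rewrite lee_fin; split => [[]|].
  by exists K => // y /andP[y0 yK]; split => // _; rewrite leey.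
pose f y := unit_cost I * y + G (x + y).
have cf : continuous f.
  move=> y; apply: cvgD; first by apply: cvgMl_tmp; exact: cvg_id.
  apply: (@continuous_comp _ _ _ (fun y => x + y) G); last exact: cG.
  by apply: cvgD; [exact: cvg_cst|exact: cvg_id].
have m_ge0 : 0 <= Num.min k K by rewrite le_min k0.
have [y1] := EVT_min m_ge0 (continuous_subspaceT cf).
rewrite in_itv/= le_min => /andP[y10 /andP[y1k y1K]] y1min.
have Py1 : feasible I x y1 by apply/kE; rewrite ?y10.
have costE y : order_cost G x y = fixed_cost I * (0 < y)%R%:R + f y.
  by rewrite /order_cost /f addrA.
have ub y : 0 < y -> feasible I x y ->
    G x <= order_cost G x y \/ order_cost G x y1 <= order_cost G x y.
  move=> y0 xy; have [Ky|yK] := leP K y.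
    by left; rewrite -KE (le_trans _ (unit_cost_le_order_cost G x y G0))// ler_pM2l.
  right; rewrite !costE lerD//; last first.
    apply: y1min; rewrite in_itv/= le_min (ltW y0) (ltW yK) andbT/=.
    by apply/kE => //; rewrite (ltW y0) ltW.
  by rewrite y0 ler_wpM2l ?(ltW c10)//; case: (0 < y1).
have [le1|lt1] := leP (G x) (order_cost G x y1).
- exists 0; split => [|y xy]; first exact: feasible0.
  rewrite order_cost0; have [y0|y0] := ltP 0 y.
    by case: (ub y y0 xy) => //; exact: le_trans.
  have -> : y = 0 by case: xy => ? _; apply/eqP; rewrite eq_le y0.
  by rewrite order_cost0.
- exists y1; split => // y xy; have [y0|y0] := ltP 0 y.
    by case: (ub y y0 xy) => // /(lt_le_trans lt1)/ltW.
  have -> : y = 0 by case: xy => ? _; apply/eqP; rewrite eq_le y0.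
  by rewrite order_cost0 ltW.
Qed.

Lemma value_optimal_order (G : R -> R) (u : R -> R -> \bar R) x y :
  (forall y', feasible I x y' -> u x y' = (order_cost G x y')%:E) ->
  optimal_order G x y -> value I u x = (order_cost G x y)%:E.
Proof.
move=> uG [xy ymin]; apply/eqP; rewrite eq_le; apply/andP; split.
  by rewrite -uG//; exact: value_le_feasible.
by apply: le_ereal_inf_tmp => _ [y' xy' <-]; rewrite uG// lee_fin ymin.
Qed.

(** Starting from [x'], imitate an optimal order [y] of [x] by the nearby feasible
    order [z <= y]. Only the cost-to-go can increase, and the stocks after ordering
    differ by at most [2 * `|x - x'|], so uniform continuity of [G] concludes. Optimal
    orders stay bounded for [x] near [x0], so this takes place in a fixed segment. *)
Lemma value_upper_modulus (G : R -> R) (u : R -> R -> \bar R) :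
  (forall x y, X x -> feasible I x y -> u x y = (order_cost G x y)%:E) ->
  continuous G -> (forall z, 0 <= G z) ->
  forall x0 e, 0 < e -> exists2 r, 0 < r & forall x x', X x -> X x' ->
    `|x - x0| < r -> `|x' - x0| < r ->
    fine (value I u x') <= fine (value I u x) + e.
Proof.
move=> uG cG G0 x0 e e0; have c20 := unit_cost_gt0 HI.
have x01 : x0 - 1 <= x0 + 1 by lra.
have [xm _ Gm] := EVT_max x01 (continuous_subspaceT cG).
pose K := G xm / unit_cost I.
have [r r0 unifG] := segment_uniform G (x0 - 1) (x0 + 1 + K) cG e e0.
(* For states within [r / 4] of [x0], the orders [y] and [z] below lead to stocks
   within [r] of each other. *)
exists (Num.min 1 (r / 4)) => [|x x' Xx Xx']; first by rewrite lt_min ltr01 divr_gt0.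
rewrite !lt_min => /andP[xx1 xxr] /andP[_ xxr'].
have [y yopt] := optimal_order_exists G x cG G0 Xx.
have [y' y'opt] := optimal_order_exists G x' cG G0 Xx'.
rewrite (value_optimal_order G u x y (fun y => uG x y Xx) yopt).
rewrite (value_optimal_order G u x' y' (fun y => uG x' y Xx') y'opt) /=.
have [[y0 _] ymin] := yopt; have [_ y'min] := y'opt.
have [z [x'z zy yz]] := feasible_nearby x x' y Xx' (proj1 yopt).
apply: le_trans (y'min z x'z) _.
have yK : y <= K.
  rewrite ler_pdivlMr// mulrC.
  apply: le_trans (unit_cost_le_order_cost G x y G0) _.
  apply: le_trans (ymin 0 (feasible0 x Xx)) _.
  rewrite order_cost0; apply: Gm.
  by move: xx1; rewrite ltr_norml in_itv/=; lra.
have /unifG : x0 - 1 <= x + y <= x0 + 1 + K.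
  by move: xx1; rewrite ltr_norml; lra.
move=> /(_ (x' + z))/(_ _)/ltW; have -> : x + y - (x' + z) = (x - x') + (y - z) by ring.
have xx' : `|x - x'| < r / 2.
  by rewrite (le_lt_trans (ler_distD x0 x x'))// [`|x0 - x'|]distrC; lra.
have yz0 : `|y - z| = y - z by rewrite ger0_norm// subr_ge0.
rewrite (le_lt_trans (ler_normD _ _)) ?yz0; last by lra.
move=> /(_ isT); rewrite distrC ler_norml => /andP[_ Gzy].
rewrite /order_cost -[leRHS]addrA lerD//; last by lra.
rewrite lerD ?ler_wpM2l ?(ltW c20) ?(ltW (fixed_cost_gt0 HI))//.
rewrite ler_nat; case: (ltP 0 z) => // z0.
by rewrite (lt_le_trans z0 zy).
Qed.

Lemma continuous_value (G : R -> R) (u : R -> R -> \bar R) :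
  (forall x y, X x -> feasible I x y -> u x y = (order_cost G x y)%:E) ->
  continuous G -> (forall z, 0 <= G z) ->
  continuous (fun z => fine (value I u (to_state z))).
Proof.
move=> uG cG G0 z; apply/cvgrPdist_le => e e0.
have [r r0 modu] := value_upper_modulus G u uG cG G0 (to_state z) e e0.
have /cvgrPdist_lt/(_ r r0) := continuous_to_state z.
apply: filterS => z' zz'.
have Xz := to_state_in z; have Xz' := to_state_in z'.
have zz0 : `|to_state z - to_state z| < r by rewrite subrr normr0.
have z'z : `|to_state z' - to_state z| < r by rewrite distrC.
have := modu _ _ Xz Xz' zz0 z'z; have := modu _ _ Xz' Xz z'z zz0.
by move=> *; rewrite ler_norml; apply/andP; split; lra.
Qed.

(** * Value functions *)

Lemma opt_value0 x : X x -> opt_value I 0 x = 0%E.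
Proof.
move=> Xx; rewrite /opt_value /value /=.
rewrite (_ : [set _ | _ in _] = [set 0%E]) ?ereal_inf1//.
by apply/seteqP; split => [_ [y _ <-]//|_ ->]; exists 0 => //; exact: feasible0.
Qed.

Lemma opt_value_step (q : R -> \bar R) (V : R -> R) t : tail_bound q ->
  dominated q (opt_value I t) -> continuous V -> (forall x, 0 <= V x) ->
  (forall x, X x -> opt_value I t x = (V x)%:E) ->
  exists2 W : R -> R, [/\ continuous W, forall x, 0 <= W x &
    forall x, X x -> opt_value I t.+1 x = (W x)%:E] &
    forall x, X x -> exists2 y, feasible I x y &
      objective I t.+1 x y = opt_value I t.+1 x.
Proof.
move=> tq vq cV V0 vV.
have [G [cG G0] uG] := bellman_order_cost _ _ _ tq vq cV V0 vV.
have opt x : X x -> exists2 y, feasible I x y &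
    objective I t.+1 x y = opt_value I t.+1 x /\
    opt_value I t.+1 x = (order_cost G x y)%:E.
  move=> Xx; have [y yopt] := optimal_order_exists G x cG G0 Xx.
  have := value_optimal_order G (bellman I (opt_value I t)) x y.
  move=> /(_ (fun y => uG x y Xx) yopt) vE.
  by exists y; [exact: yopt.1|rewrite [LHS](uG x y Xx yopt.1) [opt_value _ _ _]vE].
have val_fin x : X x -> exists2 r : R, 0 <= r & opt_value I t.+1 x = r%:E.
  move=> /opt[y [y0 _] [_ ->]]; exists (order_cost G x y) => //.
  apply: le_trans (unit_cost_le_order_cost G x y G0).
  by rewrite mulr_ge0// ltW// (unit_cost_gt0 HI).
exists (fun x => fine (opt_value I t.+1 (to_state x))); last first.
  by move=> x /opt[y xy [? _]]; exists y.
split=> [|x|x Xx].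
- exact: continuous_value uG cG G0.
- by have [r r0 ->] := val_fin _ (to_state_in x).
- by rewrite to_state_id//; have [r _ ->] := val_fin _ Xx.
Qed.

(** The induction carries the domination by the [t]-th tail along with continuity,
    because it is what makes the next expectation finite and continuous. *)
Lemma opt_value_continuous (Hacc : inventory_accessible) t :
  exists2 V : R -> R, continuous V &
    forall x, X x -> opt_value I t x = (V x)%:E /\
      exists2 y, feasible I x y & objective I t x y = opt_value I t x.
Proof.
have [Q [tQ stepQ]] := tail_family Hacc.
suff: exists2 V : R -> R, [/\ continuous V, forall x, 0 <= V x &
    forall x, X x -> opt_value I t x = (V x)%:E] &
    dominated (Q t) (opt_value I t) /\
    forall x, X x ->
      exists2 y, feasible I x y & objective I t x y = opt_value I t x.
  by move=> [V [cV _ vV] [_ opt]]; exists V => // x Xx; split; [exact: vV|exact: opt].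
elim: t => [|t [V [cV V0 vV] [vQ _]]].
  exists (cst 0); first by split => // [x|x /opt_value0//]; exact: cvg_cst.
  split=> [b Xb|x Xx].
    exists 0 => // x Xx _; rewrite opt_value0// add0e.
    by case: (tQ 0).
  by exists 0; [exact: feasible0|rewrite opt_value0].
have [W WP opt] := opt_value_step _ _ _ (tQ t) vQ cV V0 vV.
exists W => //; split => //.
by apply: (stepQ t (opt_value I t)) => // x Xx; rewrite vV// lee_fin.
Qed.

End Model.

Theorem theorem14 (R : realType) (d : measure_display) (Omega : measurableType d)
    (P : probability Omega R) (I : inventory P) (HI : inventory_axioms I)
    (Hacc : mode I = Backorders -> (max_order I < +oo)%E ->
      forall (n : nat) (z : R), state I z -> (holding_after I n z < +oo)%E) :
  (forall t : nat,
      (forall x, state I x -> opt_value I t x \is a fin_num)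
      /\ {within state I, continuous (fun x => fine (opt_value I t x))})
  /\ (forall x, state I x -> opt_value I 0 x = 0%E)
  /\ (forall (t : nat) (x : R), state I x ->
        is_minimum [set bellman I (opt_value I t) x y | y in feasible I x]
          (opt_value I t.+1 x))
  /\ (forall t : nat, exists phi : 'I_t.+1 -> R -> R, optimal_policy I phi).
Proof.
have main := opt_value_continuous HI Hacc.
split=> [t|].
  have [V cV vV] := main t; split=> [x /vV[-> _]//|].
  apply: (@subspace_eq_continuous _ _ _ V); last exact: continuous_subspaceT.
  by move=> x /set_mem/vV[vx _]; rewrite -[RHS]/(fine (opt_value I t x)) vx.
split; first exact: opt_value0.
split=> [t x Xx|t].
  have [_ _ /(_ x Xx)[_ [y xy uy]]] := main t.+1.
  split; first by exists y.
  by move=> _ [y' xy' <-]; exact: value_le_feasible.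
exists (fun s x => xget 0
  [set y | feasible I x y /\ objective I s x y = opt_value I s x]).
move=> s x Xx; have [_ _ /(_ x Xx)[_ [y xy uy]]] := main s.
have := @xgetPex _ 0
  [set y | feasible I x y /\ objective I s x y = opt_value I s x].
by apply; exists y.
Qed.
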